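(* Let $k\ge 1$ and $n \ge 2k+1$ be integers and let $\mathcal{F} \subset \binom{[n]}{k}$ be an intersecting family. Then the $(2k+1)$-th largest degree of $\mathcal{F}$ satisfies $$d_{2k+1}(\mathcal{F})\le \binom{n-2}{k-2}.$$
   Context: $[n]=\{1,\dots,n\}$ and $\binom{[n]}{k}$ is the family of all $k$-element subsets of $[n]$. A family $\mathcal{F}$ of sets is intersecting if $|A\cap B|\ge 1$ for all $A,B\in\mathcal{F}$. The degree of $i\in[n]$ in $\mathcal{F}$ is the number of sets $A\in\mathcal{F}$ with $i\in A$. The $n$ degrees of the elements of $[n]$ (counted with multiplicity) are arranged in non-increasing order $d_1(\mathcal{F})\ge d_2(\mathcal{F})\ge\cdots\ge d_n(\mathcal{F})$, so $d_r(\mathcal{F})$ is the $r$-th largest degree. Convention: $\binom{a}{b}=0$ for $b<0$. *)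

(* Defs.v *)
From mathcomp Require Import all_boot all_order all_algebra.

Set Implicit Arguments.
Unset Strict Implicit.
Unset Printing Implicit Defensive.

(* The ground set [n] = {1, ..., n} is represented by 'I_n = {0, ..., n-1}. *)

Definition k_subsets (n k : nat) : {set {set 'I_n}} :=
  [set A : {set 'I_n} | #|A| == k].

Definition intersecting (n : nat) (F : {set {set 'I_n}}) : Prop :=
  forall A B : {set 'I_n}, A \in F -> B \in F -> 1 <= #|A :&: B|.

Definition degree (n : nat) (F : {set {set 'I_n}}) (i : 'I_n) : nat :=
  #|[set A in F | i \in A]|.

Definition degree_seq (n : nat) (F : {set {set 'I_n}}) : seq nat :=
  sort geq [seq degree F i | i <- enum 'I_n].

(* The ranks r = 1, ..., n are counted from 1, whereas nth counts from 0;
   only 1 <= r <= n is meaningful. *)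
Definition ranked_degree (n : nat) (F : {set {set 'I_n}}) (r : nat) : nat :=
  nth 0 (degree_seq F) r.-1.

(* Binomial coefficient with integer lower index, zero when that is negative:
   with truncated subtraction, 'C(n - 2, k - 2) would be 1 at k = 1. *)
Definition binomz (a : nat) (b : int) : nat :=
  if b is Posz m then 'C(a, m) else 0.

(* Main.v *)
Require Import Defs.
From mathcomp Require Import all_boot all_order all_algebra.
From mathcomp Require Import ring lra zify.

(** Suppose that more than [2k] elements had degree above
    [D = C(n-2,k-2)], and let [Y] consist of [2k+1] of them.

    _Reduction to [Y]._  Replacing an element outside [Y] by one of [Y], in
    all sets of the family where this creates no collision, keeps the family
    intersecting and lowers no degree in [Y].  In a family that no such shift
    can change, the traces [A :&: Y] pairwise meet ([exists_shifted],
    [shifted_traces_meet]): if [A] and [B] met outside [Y] only, then, as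
    [A :|: B] has fewer than [2k+1] elements, a common element could be
    exchanged in [A] for an element of [Y] lying in neither set, until [A] and
    [B] became disjoint.  What remains is a problem about subsets of a set of
    [2k+1] points: for [1 <= j <= k], a function [f_j] on the [j]-subsets with
    values in [[0,1]], namely the number of members with a given trace over
    its largest possible value [w_j = C(n-2k-1,k-j)], such that no two
    disjoint sets both get a nonzero value.

    _Averaging._  A point of degree at most [D] is found by choosing a member
    [A] with probability proportional to [#|A :&: Y| - 1], and then a uniform
    point of [Y] outside [A].  In a star this never chooses the centre, and
    all other degrees equal [D].  The claim [coweight_average_le] is that the
    expected degree of the chosen point is at most [D] in general.

    _The quadratic inequality._  The claim is quadratic in the [f_j], with
    equality for stars.  As [f_j] has values in [[0,1]], its total is at least
    its squared norm; and the sums of [f_i S * f_j T] over disjoint [S], [T]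
    vanish, so they may be added with any coefficients.  The coefficients
    [alpha] below are such that the stars belong to the kernel of the
    resulting quadratic form.  Every [f_j] is the sum of a linear function
    [S |-> \sum_(y in S) b y] and a harmonic one, whose degrees all vanish
    ([lin_harmonic_decomp]), and the form splits accordingly.  On the linear
    parts it is a sum of variances ([weighted_squares]).  On the harmonic
    parts the disjointness sums are small ([disj_harmonic_bound]), because
    [up], which sums a function over the subsets with one element less, has
    small norm on harmonic functions ([norm_up_harmonic]); and [row_bound]
    shows that they are small enough.  The weighted count of a star that gives
    [D] is evaluated in [weighted_vandermonde]. *)

Set Implicit Arguments.
Unset Strict Implicit.
Unset Printing Implicit Defensive.
Import Order.TTheory GRing.Theory Num.Theory.

(** * Harmonic functions on the subsets of a finite set *)

Section Ops.
Local Open Scope ring_scope.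
Variables (R : realFieldType) (V : finType).
Implicit Types f g h : {set V} -> R.

Definition dot f g := \sum_S f S * g S.
Definition up f (W : {set V}) := \sum_(x in W) f (W :\ x).
Definition down f (S : {set V}) := \sum_(x in ~: S) f (x |: S).
Definition on_level (l : nat) f := forall S : {set V}, #|S| != l -> f S = 0.
Definition total f := \sum_S f S.
(** The degree of [y] in a weighted family; [harmonic] functions are thus those
    orthogonal to all stars. *)
Definition wdegree f (y : V) := \sum_(S : {set V} | y \in S) f S.
Definition harmonic f := forall y, wdegree f y = 0.

Lemma dot_ge0 f : 0 <= dot f f.
Proof. by apply: sumr_ge0 => S _; rewrite -expr2 sqr_ge0. Qed.

Lemma dot_eq0 f : dot f f = 0 -> forall S, f S = 0.
Proof.
move=> /eqP; rewrite psumr_eq0; last by move=> S _; rewrite -expr2 sqr_ge0.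
by move=> /allP f0 S; move: (f0 S (mem_index_enum S)); rewrite mulf_eq0 orbb => /eqP.
Qed.

Lemma dotC f g : dot f g = dot g f.
Proof. by apply: eq_bigr => S _; rewrite mulrC. Qed.

Lemma cauchy_schwarz f g : dot f g ^+ 2 <= dot f f * dot g g.
Proof.
have [f0|fn0] := eqVneq (dot f f) 0.
  rewrite f0 mul0r /dot big1 ?expr0n // => S _.
  by rewrite (dot_eq0 f0) mul0r.
have fp : 0 < dot f f by rewrite lt_def fn0 dot_ge0.
set A := dot f f in fp *; set B := dot f g; set C := dot g g.
have : 0 <= dot (fun S => A * g S - B * f S) (fun S => A * g S - B * f S) by exact: dot_ge0.
have ex a b : dot (fun S => a * g S - b * f S) (fun S => a * g S - b * f S)
    = a ^+ 2 * C - 2 * a * b * B + b ^+ 2 * A.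
  rewrite /A /B /C /dot !mulr_sumr -sumrB -big_split /=.
  by apply: eq_bigr => S _; ring.
rewrite ex.
have -> : A ^+ 2 * C - 2 * A * B * B + B ^+ 2 * A = A * (A * C - B ^+ 2) by ring.
by rewrite pmulr_rge0 // subr_ge0.
Qed.

(** Both sides run over the pairs of a set and a set with one more element. *)
Lemma flag_sum (F : V -> {set V} -> {set V} -> R) :
  \sum_(W : {set V}) \sum_(x in W) F x (W :\ x) W
  = \sum_(S : {set V}) \sum_(x in ~: S) F x S (x |: S).
Proof.
rewrite (exchange_big_dep predT) //= [RHS](exchange_big_dep predT) //=.
apply: eq_bigr => x _.
rewrite (reindex_onto (fun S => x |: S) (fun W => W :\ x)) /=; last first.
  by move=> W xW; rewrite setD1K.
apply: eq_big => [S | S /andP[_ /eqP e]]; last by rewrite e.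
rewrite setU11 inE /=; apply/eqP/idP => [<- | xS]; first by rewrite !inE eqxx.
by rewrite setU1K.
Qed.

Lemma dot_up f g : dot (up f) g = dot f (down g).
Proof.
rewrite /dot; under eq_bigr do rewrite mulr_suml.
rewrite (flag_sum (fun x S W => f S * g W)).
by apply: eq_bigr => S _; rewrite mulr_sumr.
Qed.

(** Adding an element and then removing another one commutes, so only the
    terms where the same element is added and removed differ: [#|V| - #|S|] of
    them on one side, [#|S|] on the other. *)
Lemma down_up f S :
  down (up f) S = up (down f) S + (#|V|%:R - 2 * #|S|%:R) * f S.
Proof.
have -> : down (up f) S =
    (\sum_(x in ~: S) \sum_(z in S) f (x |: (S :\ z))) + #|~: S|%:R * f S.
  rewrite mulr_natl -sumr_const -big_split /=; apply: eq_bigr => x; rewrite inE => xS.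
  rewrite /up big_setU1 //= setU1K // addrC; congr (_ + _).
  apply: eq_bigr => z zS; congr f; apply/setP => t; rewrite !inE.
  by case: (eqVneq t z) => [->|_] //=; case: (eqVneq z x) => // e; rewrite -e zS in xS.
have -> : up (down f) S =
    (\sum_(x in ~: S) \sum_(z in S) f (x |: (S :\ z))) + #|S|%:R * f S.
  rewrite exchange_big /= mulr_natl -sumr_const -big_split /=; apply: eq_bigr => z zS.
  have -> : down f (S :\ z) = \sum_(x in z |: ~: S) f (x |: S :\ z).
    by apply: eq_bigl => x; rewrite !inE negb_and negbK.
  by rewrite big_setU1 ?inE ?zS //= setD1K // addrC.
have := cardsC S; move/(congr1 (fun n => n%:R : R)); rewrite natrD => e.
by rewrite -e; ring.
Qed.

Lemma down_on_level l f : on_level l.+1 f -> on_level l (down f).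
Proof.
move=> lf S nS; apply: big1 => x; rewrite inE => xS; apply: lf.
by rewrite cardsU1 xS.
Qed.

Lemma norm_up l f : on_level l f ->
  dot (up f) (up f) = dot (down f) (down f) + (#|V|%:R - 2 * l%:R) * dot f f.
Proof.
move=> lf; rewrite dot_up.
have -> : dot (down f) (down f) = dot f (up (down f)) by rewrite [RHS]dotC dot_up.
rewrite /dot mulr_sumr -big_split /=; apply: eq_bigr => S _.
rewrite down_up; case: (eqVneq #|S| l) => [->|/lf ->]; ring.
Qed.

Lemma total_sub_wdegree f y : total f - wdegree f y = \sum_(S : {set V} | y \notin S) f S.
Proof. by rewrite /total (bigID (fun S : {set V} => y \in S)) /= addrAC subrr add0r. Qed.

Lemma sum_wdegree l f : on_level l f -> \sum_y wdegree f y = l%:R * total f.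
Proof.
move=> lf; rewrite /wdegree (exchange_big_dep predT) //= /total mulr_sumr.
apply: eq_bigr => S _; rewrite sumr_const mulr_natl.
by case: (eqVneq #|S| l) => [->|/lf ->] //; rewrite !mul0rn.
Qed.

Lemma total_harmonic l f : on_level l.+1 f -> harmonic f -> total f = 0.
Proof.
move=> lf hf; have := sum_wdegree lf; rewrite big1 // => /esym/eqP.
by rewrite mulf_eq0 pnatr_eq0 => /eqP.
Qed.

Lemma wdegree_up l f y : on_level l f ->
  wdegree (up f) y = (#|V|%:R - l%:R) * wdegree f y + (total f - wdegree f y).
Proof.
move=> lf.
have -> : wdegree (up f) y = \sum_(W : {set V}) \sum_(x in W) f (W :\ x) * (y \in W)%:R.
  rewrite /wdegree big_mkcond /=; apply: eq_bigr => W _; rewrite -mulr_suml -/(up f W).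
  by case: (y \in W); rewrite ?mulr1 ?mulr0.
rewrite (flag_sum (fun x S W => f S * (y \in W)%:R)).
rewrite total_sub_wdegree /wdegree.
rewrite [in LHS](bigID (fun S : {set V} => y \in S) predT) /= mulr_sumr.
congr (_ + _); apply: eq_bigr => S yS.
  under eq_bigr do rewrite inE yS orbT mulr1.
  rewrite sumr_const; case: (eqVneq #|S| l) => [<-|/lf ->]; last by rewrite mul0rn mulr0.
  by rewrite -mulr_natl -(cardsC S) natrD; ring.
rewrite (bigD1 y) ?inE //= eqxx mulr1 big1 ?addr0 // => x /andP[_ xy].
by rewrite !inE eq_sym (negbTE xy) (negbTE yS) mulr0.
Qed.

Lemma up_harmonic l f : on_level l.+1 f -> harmonic f -> harmonic (up f).
Proof.
by move=> lf hf y; rewrite (wdegree_up y lf) hf (total_harmonic lf hf); ring.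
Qed.

Lemma wdegree_down l f y : on_level l.+1 f -> wdegree (down f) y = l%:R * wdegree f y.
Proof.
move=> lf.
have -> : wdegree (down f) y = \sum_S \sum_(x in ~: S) f (x |: S) * (y \in S)%:R.
  rewrite /wdegree big_mkcond /=; apply: eq_bigr => W _; rewrite -mulr_suml -/(down f W).
  by case: (y \in W); rewrite ?mulr1 ?mulr0.
rewrite -(flag_sum (fun x S W => f W * (y \in S)%:R)).
rewrite /wdegree [in RHS]big_mkcond mulr_sumr; apply: eq_bigr => W _.
case: (eqVneq #|W| l.+1) => [cW|/lf ->]; last first.
  by rewrite if_same mulr0 big1 // => x _; rewrite mul0r.
case: ifP => yW; last first.
  by rewrite mulr0 big1 // => x _; rewrite !inE yW andbF mulr0.
rewrite -mulr_sumr mulrC; congr (_ * _).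
rewrite (bigD1 y) //= !inE eqxx add0r.
rewrite (eq_bigr (fun=> 1)); last first.
  by move=> x /andP[_ xy]; rewrite !inE yW eq_sym xy.
rewrite sumr_const; congr (_%:R).
have := cardsD1 y W; rewrite yW cW add1n => -[->].
by apply: eq_card => x; rewrite !inE andbC.
Qed.

Lemma down_harmonic l f : on_level l.+1 f -> harmonic f -> harmonic (down f).
Proof. by move=> lf hf y; rewrite (wdegree_down y lf) hf mulr0. Qed.

Lemma harmonic_level1_eq0 f : on_level 1 f -> harmonic f -> forall S, f S = 0.
Proof.
move=> lf hf S; case: (eqVneq #|S| 1%N) => [/eqP/cards1P[y ->]|/lf //].
have := hf y; rewrite /wdegree (bigD1 [set y]) ?inE //= big1 ?addr0 // => T /andP[yT nT].
apply: lf; apply: contra nT => /cards1P[z eT].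
by move: yT; rewrite eT inE => /eqP ->.
Qed.

(** The factor is the sum of the increments [#|V| - 2 * j] of [norm_up] over
    [2 <= j <= l.+1]: the norm of [down] on a level is that of its adjoint [up]
    one level below, and a harmonic function on level [1] is zero, so that the
    recursion starts only at level [2]. *)
Lemma norm_up_harmonic l f : (l.+2 <= #|V|)%N -> on_level l.+1 f -> harmonic f ->
  dot (up f) (up f) <= l%:R * (#|V|%:R - l%:R - 3) * dot f f.
Proof.
elim: l f => [|l IH] f lv lf hf.
  by rewrite !mul0r /dot big1 // => W _; rewrite /up big1 ?mul0r // => x _;
     exact: harmonic_level1_eq0.
rewrite (norm_up lf); set g := down f.
have lg : on_level l.+1 g by exact: down_on_level.
have hg : harmonic g by exact: (down_harmonic lf).
have {}IH := IH g (ltnW lv) lg hg.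
set B := l%:R * _ in IH.
have B0 : 0 <= B.
  by apply: mulr_ge0; rewrite // -addrA -opprD -natrD subr_ge0 ler_nat; lia.
have g0 := dot_ge0 g; have f0 := dot_ge0 f.
(* Cauchy-Schwarz for <up g, f> = |g|^2, divided by |g|^2 *)
have key : dot g g <= B * dot f f.
  have [->|gn] := eqVneq (dot g g) 0; first exact: mulr_ge0.
  have gp : 0 < dot g g by rewrite lt_def gn.
  have := cauchy_schwarz (up g) f; rewrite dot_up -/g => cs.
  rewrite -(ler_pM2l gp) -expr2 (le_trans cs) //.
  by rewrite [leRHS]mulrA [dot g g * B]mulrC ler_wpM2r.
rewrite (_ : l.+1%:R * _ * _ = B * dot f f + (#|V|%:R - 2 * l.+2%:R) * dot f f) ?lerD2r //.
by rewrite /B -!natr1; ring.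
Qed.

(** Up to a factor [s`!], this is the [s]-th iterate of [up] on functions that
    live on level [l - s]. *)
Definition zeta l f (W : {set V}) :=
  if #|W| == l then \sum_(S : {set V} | S \subset W) f S else 0.

Lemma zeta_on_level l f : on_level l (zeta l f).
Proof. by move=> W /negbTE nW; rewrite /zeta nW. Qed.

Lemma zeta_id l f : on_level l f -> forall S, zeta l f S = f S.
Proof.
move=> lf S; rewrite /zeta; case: eqP => [cS|/eqP/lf ->] //.
rewrite (bigD1 S) //= big1 ?addr0 // => T /andP[TS nT]; apply: lf.
apply: contra nT => /eqP cT.
by rewrite eqEcard TS cS cT leqnn.
Qed.

Lemma up_zeta j s f W : on_level j f ->
  up (zeta (j + s)%N f) W = s.+1%:R * zeta (j + s)%N.+1 f W.
Proof.
move=> lf; rewrite /zeta; case: eqP => [cW|/eqP nW]; last first.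
  rewrite mulr0; apply: big1 => x xW; rewrite ifF //; apply/negbTE.
  by rewrite (cardsD1 x W) xW in nW.
rewrite /up (eq_bigr (fun x => \sum_(S : {set V} | S \subset W :\ x) f S)); last first.
  by move=> x xW; move: cW; rewrite (cardsD1 x W) xW add1n => -[->]; rewrite eqxx.
rewrite (exchange_big_dep (fun S : {set V} => S \subset W)) /=; last first.
  by move=> x S xW; rewrite subsetD1 => /andP[].
rewrite mulr_sumr; apply: eq_bigr => S SW.
rewrite sumr_const -[LHS]mulr_natl.
case: (eqVneq #|S| j) => [cS|/lf ->]; last by rewrite !mulr0.
congr (_%:R * _).
have := cardsD W S; rewrite (setIidPr SW) cW cS -addnS addKn => <-.
by apply: eq_card => x; rewrite in_setD [LHS]unfold_in subsetD1 SW andbC.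
Qed.

Lemma zeta_harmonic j s f : on_level j.+1 f -> harmonic f -> harmonic (zeta (j.+1 + s)%N f).
Proof.
move=> lf hf; elim: s => [|s IH] y.
  by rewrite addn0 -(hf y); apply: eq_bigr => S _; exact: zeta_id.
have := up_harmonic (@zeta_on_level (j + s)%N.+1 f) IH y; rewrite /wdegree.
under eq_bigr do rewrite (up_zeta s _ lf).
rewrite -mulr_sumr => /eqP; rewrite mulf_eq0 pnatr_eq0 /= => /eqP.
by rewrite addnS.
Qed.

(** The product of the factors of [norm_up_harmonic] along the levels, once the
    squared factorial relating [zeta] to the iterates of [up] is divided out,
    is a product of two binomial coefficients. *)
Lemma norm_zeta_harmonic c M s f : #|V| = (M + c + 4)%N -> (s <= M)%N ->
  on_level c.+2 f -> harmonic f ->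
  dot (zeta (c.+2 + s)%N f) (zeta (c.+2 + s)%N f) <=
    ('C(c + s, s) * 'C(M, s))%:R * dot f f.
Proof.
move=> cV sM lf hf; elim: s sM => [|s IH] sM.
  rewrite addn0 !bin0 mul1r le_eqVlt; apply/orP; left; apply/eqP.
  by apply: eq_bigr => S _; rewrite zeta_id.
have {}IH := IH (ltnW sM).
have nu := @norm_up_harmonic (c.+1 + s)%N _ _
  (@zeta_on_level (c.+2 + s)%N f) (zeta_harmonic s lf hf).
have {}nu := nu ltac:(rewrite cV; lia).
rewrite cV in nu.
have e : dot (up (zeta (c.+2 + s)%N f)) (up (zeta (c.+2 + s)%N f)) =
   s.+1%:R ^+ 2 * dot (zeta (c.+2 + s.+1)%N f) (zeta (c.+2 + s.+1)%N f).
  rewrite /dot mulr_sumr; apply: eq_bigr => W _.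
  by rewrite !(up_zeta s _ lf) addnS; ring.
rewrite e in nu; rewrite -(@ler_pM2l _ (s.+1%:R ^+ 2)) ?exprn_gt0 //.
apply: (le_trans nu).
have e1 : (s.+1 * 'C(c + s.+1, s.+1) = (c + s).+1 * 'C(c + s, s))%N.
  by rewrite addnS -mul_bin_diag.
have e2 : (s.+1 * 'C(M, s.+1) = (M - s) * 'C(M, s))%N by rewrite mul_bin_left.
have -> : s.+1%:R ^+ 2 * (('C(c + s.+1, s.+1) * 'C(M, s.+1))%:R * dot f f)
  = ((c + s).+1 * (M - s))%:R * (('C(c + s, s) * 'C(M, s))%:R * dot f f).
  rewrite !mulrA -natrX -!natrM; congr (_%:R * _).
  rewrite expnS expn1 -mulnA (mulnCA s.+1 'C(c + _, _)) mulnA e1 e2; ring.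
have -> : (c.+1 + s)%:R * ((M + c + 4)%:R - (c.+1 + s)%:R - 3)
    = ((c + s).+1 * (M - s))%:R :> R.
  rewrite natrM natrB ?(ltnW sM) // addSn; congr (_ * _).
  by rewrite -natr1 !natrD; ring.
by apply: ler_wpM2l.
Qed.

Definition disj f g := \sum_(S : {set V}) \sum_(T : {set V} | [disjoint S & T]) f S * g T.

(** This is ['C(#|V| - 3 - x, y.-1)], written as a quotient so that it is zero
    for [y = 0]. *)
Definition disj_weight (x y : nat) : R :=
  y%:R / (#|V| - 2 - x)%:R * 'C(#|V| - 2 - x, y)%:R.

(** Summing [g] over the sets disjoint from [S] is summing it over the subsets
    of the complement of [S], so that [norm_zeta_harmonic] and Cauchy-Schwarz
    bound [disj f g] by a geometric mean, here weakened to an arithmetic one. *)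
Lemma disj_harmonic_bound a c f g : (a + c + 2 <= #|V|)%N ->
  on_level a.+1 f -> harmonic f -> on_level c.+1 g -> harmonic g ->
  - (disj_weight a c * dot f f + disj_weight c a * dot g g) <= 2 * disj f g.
Proof.
move=> acv lf hf lg hg.
case: a acv lf => [|a] acv lf.
  have f0 := harmonic_level1_eq0 lf hf.
  have -> : disj f g = 0 by apply: big1 => S _; apply: big1 => T _; rewrite f0 mul0r.
  have -> : dot f f = 0 by apply: big1 => S _; rewrite f0 mul0r.
  by rewrite /disj_weight !mul0r !mulr0 addr0 oppr0.
case: c acv lg => [|c] acv lg.
  have g0 := harmonic_level1_eq0 lg hg.
  have -> : disj f g = 0 by apply: big1 => S _; apply: big1 => T _; rewrite g0 mulr0.
  have -> : dot g g = 0 by apply: big1 => S _; rewrite g0 mul0r.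
  by rewrite /disj_weight !mul0r !mulr0 addr0 oppr0.
pose s := (#|V| - a - c - 4)%N.
have cV : #|V| = (s + a + c + 4)%N by rewrite /s; lia.
have disj_weightE x y : (s + x + y + 4 = #|V|)%N -> disj_weight x.+1 y.+1 = 'C(y + s, y)%:R.
  move=> e; have e' : (#|V| - 2 - x.+1 = (y + s).+1)%N by lia.
  rewrite /disj_weight e'; have := mul_bin_diag (y + s).+1 y.
  move/(congr1 (fun n => n%:R : R)); rewrite !natrM => e2.
  apply: (@mulfI _ (y + s).+1%:R); rewrite ?pnatr_eq0 // e2.
  by rewrite mulrA mulrCA divff ?mulr1 ?pnatr_eq0 //.
rewrite disj_weightE; last by lia.
rewrite disj_weightE; last by lia.
set Z := fun S => zeta (c.+2 + s)%N g (~: S).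
have -> : disj f g = dot f Z.
  apply: eq_bigr => S _; rewrite -mulr_sumr.
  case: (eqVneq #|S| a.+2) => [cS|/lf ->]; last by rewrite !mul0r.
  rewrite /Z /zeta ifT; last by have := cardsC S; rewrite cS cV => e; apply/eqP; lia.
  by congr (_ * _); apply: eq_bigl => T; rewrite disjoint_sym disjoints_subset.
have nZ : dot Z Z <= ('C(c + s, s) * 'C(s + a, s))%:R * dot g g.
  have -> : dot Z Z = dot (zeta (c.+2 + s)%N g) (zeta (c.+2 + s)%N g).
    rewrite [RHS](reindex_inj (@setC_inj V)); exact: eq_bigr.
  by apply: norm_zeta_harmonic => //; lia.
have cs := cauchy_schwarz f Z.
have f0 := dot_ge0 f; have g0 := dot_ge0 g.
have -> : 'C(c + s, c) = 'C(c + s, s) by rewrite -[RHS]bin_sub ?leq_addl // addnK.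
have -> : 'C(a + s, a) = 'C(s + a, s) by rewrite addnC -[RHS]bin_sub ?leq_addr // addKn.
rewrite natrM in nZ; set A := 'C(c + s, s)%:R in nZ *; set B := 'C(s + a, s)%:R in nZ *.
have A0 : 0 <= A by []; have B0 : 0 <= B by [].
set x := dot f Z in cs *; set F := dot f f in cs f0 *; set G := dot g g in nZ g0 *.
have h1 : x ^+ 2 <= (A * F) * (B * G).
  by apply: (le_trans cs); rewrite mulrACA [A * B * _]mulrC -mulrA [G * _]mulrC ler_wpM2l.
have AF : 0 <= A * F by exact: mulr_ge0.
have BG : 0 <= B * G by exact: mulr_ge0.
have h2 : (2 * x) ^+ 2 <= (A * F + B * G) ^+ 2.
  have := sqr_ge0 (A * F - B * G); nra.
have : `|2 * x| <= A * F + B * G.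
  by rewrite -(ler_pXn2r (n := 2)) ?nnegrE ?normr_ge0 ?addr_ge0 // real_normK ?num_real.
by rewrite ler_norml => /andP[].
Qed.
End Ops.

(** * Linear functions on a level *)

Section Lin.
Local Open Scope ring_scope.
Variables (R : realFieldType) (V : finType).
Implicit Types (f g h : {set V} -> R) (b : V -> R).

Definition lin (l : nat) b (S : {set V}) : R :=
  if #|S| == l then \sum_(y in S) b y else 0.

Lemma lin_on_level l b : on_level l (lin l b).
Proof. by move=> S /negbTE nS; rewrite /lin nS. Qed.

Lemma card_subsets_through (B : {set V}) z c : z \in B ->
  #|[set T : {set V} | [&& T \subset B, z \in T & #|T| == c.+1]]| = 'C(#|B|.-1, c).
Proof.
move=> zB; have -> : #|B|.-1 = #|B :\ z| by rewrite (cardsD1 z B) zB.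
rewrite -cards_draws -[RHS](card_in_imset (f := fun T => z |: T)); last first.
  move=> S T; rewrite !inE; rewrite !subsetD1 => /andP[/andP[_ zS] _] /andP[/andP[_ zT] _] e.
  by rewrite -(setU1K zS) e setU1K.
apply: eq_card => T; rewrite !inE; apply/and3P/imsetP => [[TB zT /eqP cT]|[S]].
  exists (T :\ z); last by rewrite setD1K.
  by rewrite inE setSD //; move: cT; rewrite (cardsD1 z T) zT add1n => -[->]; rewrite eqxx.
rewrite inE subsetD1 => /andP[/andP[SB zS] /eqP cS] ->.
by rewrite setU11 subUset sub1set zB SB cardsU1 zS cS.
Qed.

(** All the sums of linear functions needed later are instances, with [B] the
    whole set, the complement of a point, or the complement of a set. *)
Lemma sum_lin_subsets (B : {set V}) c b :
  \sum_(T : {set V} | T \subset B) lin c.+1 b T = 'C(#|B|.-1, c)%:R * \sum_(z in B) b z.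
Proof.
rewrite /lin -big_mkcondr /= (exchange_big_dep (fun z => z \in B)) /=; last first.
  by move=> T z /andP[/subsetP TB _] /TB.
rewrite mulr_sumr; apply: eq_bigr => z zB.
rewrite sumr_const -[LHS]mulr_natl; congr (_%:R * _).
rewrite -(card_subsets_through c zB); apply: eq_card => T.
by rewrite [RHS]inE [LHS]unfold_in -andbA; congr (_ && _); rewrite andbC.
Qed.

Lemma dot_lin l b f : on_level l f -> dot (lin l b) f = \sum_y b y * wdegree f y.
Proof.
move=> lf; rewrite /wdegree; under [RHS]eq_bigr do rewrite mulr_sumr.
rewrite (exchange_big_dep predT) //=; apply: eq_bigr => S _.
by rewrite -mulr_suml /lin; case: eqP => // /eqP/lf ->; rewrite !mulr0.
Qed.

Lemma total_lin a b : total (lin a.+1 b) = 'C(#|V|.-1, a)%:R * \sum_y b y.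
Proof.
rewrite -cardsT (eq_bigl (fun y => y \in [set: V])); last by move=> y; rewrite inE.
by rewrite -sum_lin_subsets; apply: eq_bigl => S; rewrite subsetT.
Qed.

(** The complementary degree has a simpler form than the degree, whose formula
    would involve a binomial coefficient with a negative lower index on
    level [1]. *)
Lemma cowdegree_lin a b y :
  total (lin a.+1 b) - wdegree (lin a.+1 b) y = 'C(#|V|.-2, a)%:R * (\sum_z b z - b y).
Proof.
rewrite total_sub_wdegree.
have -> : #|V|.-2 = #|[set~ y]|.-1 by rewrite cardsC1.
have -> : \sum_z b z - b y = \sum_(z in [set~ y]) b z.
  rewrite (bigD1 y) //= addrAC subrr add0r.
  by apply: eq_bigl => z; rewrite !inE.
rewrite -sum_lin_subsets; apply: eq_bigl => S.
by rewrite -setCS setCK sub1set inE.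
Qed.

Lemma disj_lin a c b f : on_level a.+1 f ->
  disj f (lin c.+1 b) = 'C(#|V| - a.+2, c)%:R * \sum_z b z * (total f - wdegree f z).
Proof.
move=> lf; rewrite /disj.
have e (S : {set V}) : \sum_(T : {set V} | [disjoint S & T]) f S * lin c.+1 b T
    = f S * ('C(#|~: S|.-1, c)%:R * \sum_(z in ~: S) b z).
  rewrite -sum_lin_subsets mulr_sumr; apply: eq_bigl => T.
  by rewrite disjoint_sym disjoints_subset.
under eq_bigr do rewrite e.
transitivity ('C(#|V| - a.+2, c)%:R * \sum_(S : {set V}) \sum_(z in ~: S) b z * f S).
  rewrite mulr_sumr; apply: eq_bigr => S _; rewrite -mulr_suml.
  case: (eqVneq #|S| a.+1) => [cS|/lf ->]; last by rewrite !(mul0r, mulr0).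
  have -> : (#|V| - a.+2 = #|~: S|.-1)%N by rewrite -(cardsC S) cS; lia.
  by ring.
congr (_ * _); rewrite (exchange_big_dep predT) //=; apply: eq_bigr => z _.
rewrite total_sub_wdegree mulr_sumr; apply: eq_bigl => S; by rewrite inE.
Qed.

Lemma disjC f g : disj f g = disj g f.
Proof.
rewrite /disj (exchange_big_dep predT) //=; apply: eq_bigr => S _.
under eq_bigl do rewrite disjoint_sym.
by apply: eq_bigr => T _; rewrite mulrC.
Qed.

Lemma disjDl f f' g : disj (fun S => f S + f' S) g = disj f g + disj f' g.
Proof.
rewrite /disj -big_split; apply: eq_bigr => S _; rewrite -big_split.
by apply: eq_bigr => T _; rewrite mulrDl.
Qed.

Lemma disjDr f g g' : disj f (fun S => g S + g' S) = disj f g + disj f g'.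
Proof. by rewrite disjC disjDl !(disjC f). Qed.

(** The coefficients [b] are read off from [total_lin] and [cowdegree_lin], by
    requiring that [lin a.+1 b] has the same total and degrees as [f].  It has
    to be checked that the sum of the [b y] is then the one prescribed by the
    total, which is where [sum_wdegree] comes in. *)
Lemma lin_harmonic_decomp a f : (a.+1 < #|V|)%N -> on_level a.+1 f ->
  exists b h, [/\ forall S, f S = lin a.+1 b S + h S, on_level a.+1 h, harmonic h & total h = 0].
Proof.
move=> av lf.
have r0 : 'C(#|V|.-2, a)%:R != 0 :> R by rewrite pnatr_eq0 -lt0n bin_gt0; lia.
have q0 : 'C(#|V|.-1, a)%:R != 0 :> R by rewrite pnatr_eq0 -lt0n bin_gt0; lia.
pose be := total f / 'C(#|V|.-1, a)%:R.
pose b y := be - (total f - wdegree f y) / 'C(#|V|.-2, a)%:R.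
have sb : \sum_y b y = be.
  rewrite sumrB sumr_const -mulr_suml sumrB (sum_wdegree lf) sumr_const.
  have e : ((#|V| - a.+1) * 'C(#|V|.-1, a) = #|V|.-1 * 'C(#|V|.-2, a))%N.
    rewrite mul_bin_down; congr (_ * _)%N; lia.
  move/(congr1 (fun n => n%:R : R)): e; rewrite !natrM natrB ?(ltnW av) //.
  have e2 : #|V|%:R = #|V|.-1%:R + 1 :> R by rewrite natr1 prednK //; lia.
  rewrite -[be *+ _]mulr_natl -[total f *+ _]mulr_natl e2 => e.
  have e3 : be * #|V|.-1%:R = (#|V|.-1%:R + 1 - a.+1%:R) * total f / 'C(#|V|.-2, a)%:R.
    apply: (mulIf r0); rewrite divfK // -mulrA -e /be.
    by field.
  transitivity (be + (be * #|V|.-1%:R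
      - (#|V|.-1%:R + 1 - a.+1%:R) * total f / 'C(#|V|.-2, a)%:R)).
    by ring.
  by rewrite e3; ring.
pose h S := f S - lin a.+1 b S.
have lh : on_level a.+1 h by move=> S nS; rewrite /h lf // lin_on_level // subrr.
have th : total h = 0.
  rewrite /total sumrB -/(total f) -/(total (lin a.+1 b)) total_lin sb /be.
  by rewrite mulrC divfK // subrr.
exists b, h; split => //; first by move=> S; rewrite /h addrC subrK.
move=> y; have : total h - wdegree h y = 0.
  have -> : total h - wdegree h y =
      (total f - wdegree f y) - (total (lin a.+1 b) - wdegree (lin a.+1 b) y).
    by rewrite /h /total /wdegree !sumrB; ring.
  rewrite cowdegree_lin sb /b; field.
  exact: r0.
by rewrite th sub0r => /eqP; rewrite oppr_eq0 => /eqP.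
Qed.
End Lin.

(** * Two scalar inequalities *)

Section Scalar.
Local Open Scope ring_scope.
Variable (R : realFieldType).

(** If the [P a] sum to [1], the difference of the two sides is the weighted sum
    of the [u a * (x a - m) ^+ 2], where [m] is the [P]-mean of [x] and [U]
    that of [u]. *)
Lemma weighted_squares n (P u x : 'I_n -> R) (U : R) :
  (forall a, 0 <= P a) -> (forall a, 0 <= u a) ->
  \sum_a P a * u a = (\sum_a P a) * U ->
  \sum_a \sum_c P a * P c * (u a + u c - U) * (x a * x c)
    <= (\sum_a P a) * \sum_a P a * u a * x a ^+ 2.
Proof.
move=> P0 u0; set D := \sum_a P a => eU.
have D0 : 0 <= D by apply: sumr_ge0.
set X := \sum_a P a * x a; set Z := \sum_a P a * u a * x a; set Q := \sum_a _ * _ ^+ 2.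
have -> : \sum_a \sum_c P a * P c * (u a + u c - U) * (x a * x c) = 2 * Z * X - U * X ^+ 2.
  transitivity (\sum_a (P a * u a * x a * X + P a * x a * Z - U * (P a * x a * X))).
    apply: eq_bigr => a _; rewrite /X /Z !mulr_sumr -big_split -sumrB /=.
    by apply: eq_bigr => c _; ring.
  by rewrite sumrB big_split /= -!mulr_sumr -!mulr_suml -/X -/Z; ring.
have sq : 0 <= \sum_a P a * u a * (D * x a - X) ^+ 2.
  by apply: sumr_ge0 => a _; apply: mulr_ge0; [apply: mulr_ge0|apply: sqr_ge0].
have e : \sum_a P a * u a * (D * x a - X) ^+ 2 = D * (D * Q - (2 * Z * X - U * X ^+ 2)).
  transitivity (\sum_a (D ^+ 2 * (P a * u a * x a ^+ 2) - 2 * D * X * (P a * u a * x a)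
      + X ^+ 2 * (P a * u a))).
    by apply: eq_bigr => a _; ring.
  by rewrite big_split sumrB /= -!mulr_sumr eU -/Q -/Z; ring.
rewrite e in sq.
have [Dz|Dn] := eqVneq D 0.
  have Pz a : P a = 0.
    by apply/eqP; have /eqP := Dz; rewrite psumr_eq0 // => /allP /(_ a (mem_index_enum a)).
  have -> : X = 0 by apply: big1 => a _; rewrite Pz mul0r.
  by rewrite Dz; lra.
have Dp : 0 < D by rewrite lt_def Dn.
by rewrite pmulr_rge0 // subr_ge0 in sq.
Qed.

(** For a probability [P] with mean [K], writing [c * (K - c)] as
    [- (c - K) ^+ 2 - c * K + K ^+ 2] makes the left-hand side affine in [c]
    up to a term of negative sign.  The average of the affine part increases
    with [K], and the identity at the end writes the gap that remains as a sum
    of nonnegative terms.  Equality holds when [a], [c] and [K] all equal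
    [k - 1], that is for uniform families on [2k+1] points. *)
Lemma row_bound k (P : 'I_k -> R) (K : R) a : (0 < a < k)%N ->
  (forall c, 0 <= P c) ->
  \sum_c P c * c%:R = (\sum_c P c) * K -> K <= k%:R - 1 ->
  \sum_(c < k) P c * ((a%:R * (2 * k%:R - c%:R) + c%:R * (2 * k%:R - a%:R)) / 2
       + a%:R * c%:R * (2 * k%:R - a%:R - c%:R + K))
   <= a%:R * (2 * k%:R - a%:R) * (2 * k%:R - 1 - a%:R) * \sum_c P c.
Proof.
move=> /andP[a0 ak] P0; set D := \sum_c P c => eK Kk.
have D0 : 0 <= D by apply: sumr_ge0.
have a1 : 1 <= a%:R :> R by rewrite ler1n.
have ak1 : a%:R <= k%:R - 1 :> R by rewrite lerBrDr natr1 ler_nat.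
set x : R := a%:R in a1 ak1 *; set m : R := k%:R in Kk ak1 *.
have sq : 0 <= \sum_c P c * (c%:R - K) ^+ 2.
  by apply: sumr_ge0 => c _; rewrite mulr_ge0 ?sqr_ge0.
have -> : \sum_(c < k) P c * ((x * (2 * m - c%:R) + c%:R * (2 * m - x)) / 2
       + x * c%:R * (2 * m - x - c%:R + K))
   = D * (x * m + K * (m - x) + x * K * (2 * m - x)) - x * \sum_c P c * (c%:R - K) ^+ 2.
  transitivity (\sum_(c < k) ((x * m + x * K ^+ 2) * P c
     + (m - x + x * (2 * m - x) - x * K) * (P c * c%:R)
     - x * (P c * (c%:R - K) ^+ 2))).
    by apply: eq_bigr => c _; field.
  by rewrite sumrB big_split /= -!mulr_sumr eK -/D; ring.
have -> : x * (2 * m - x) * (2 * m - 1 - x) * D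
    = D * (x * (2 * m - x) * (2 * m - 1 - x)) by ring.
apply: (@le_trans _ _ (D * (x * m + K * (m - x) + x * K * (2 * m - x)))).
  by rewrite lerBlDr lerDl mulr_ge0 //; lra.
apply: ler_wpM2l => //.
have h1 : 0 <= (x - 1) * (m - 1 - x) by apply: mulr_ge0; lra.
have h2 : 0 <= (2 * m - x) * ((x - 1) * (m - 1 - x)) by apply: mulr_ge0 => //; lra.
have h3 : 0 <= (m - 1 - K) * (m - x) by apply: mulr_ge0; lra.
have h4 : 0 <= (m - 1 - K) * (x * (2 * m - x)) by apply: mulr_ge0; [lra|apply: mulr_ge0; lra].
have h5 : 0 <= m * (m - 1 - x) by apply: mulr_ge0; lra.
rewrite -subr_ge0.
have -> : x * (2 * m - x) * (2 * m - 1 - x) - (x * m + K * (m - x) + x * K * (2 * m - x))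
 = (2 * m - x) * ((x - 1) * (m - 1 - x)) + (m - 1 - K) * (m - x)
   + (m - 1 - K) * (x * (2 * m - x)) + m * (m - 1 - x) by ring.
lra.
Qed.
End Scalar.

(** * A vertex of small degree on 2k+1 points *)

Section Key.
Local Open Scope ring_scope.
Variables (R : realFieldType) (V : finType) (k : nat).
Hypothesis cV : #|V| = (2 * k + 1)%N.
Variables (w : 'I_k -> R) (f : 'I_k -> {set V} -> R).
Hypothesis w0 : forall a, 0 <= w a.
Hypothesis lf : forall a : 'I_k, on_level a.+1 (f a).
Hypothesis norm_le : forall a, dot (f a) (f a) <= total (f a).
Hypothesis dis0 : forall a c, disj (f a) (f c) = 0.

(** Levels are indexed from zero: [a] stands for the sets of size [a.+1].  On
    that level the star of a point has [star_tot a] members, of which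
    [star_co a] avoid, and [star_pair a] contain, a given second point.  So [D]
    is the common degree of the other points in the weighted star, and [K] is
    the mean index of the members that contain two given points. *)
Let star_tot (a : nat) : R := 'C(2 * k, a)%:R.
Let star_co (a : nat) : R := 'C((2 * k).-1, a)%:R.
Let star_pair (a : nat) : R := star_tot a - star_co a.
Let P (a : 'I_k) := w a * star_pair a.
Let D := \sum_a P a.
Let K := (\sum_a P a * a%:R) / D.

Lemma star_co_gt0 (a : 'I_k) : 0 < star_co a.
Proof. by rewrite ltr0n bin_gt0; have := ltn_ord a; lia. Qed.

Lemma star_pair_co (a : 'I_k) : (2 * k%:R - a%:R) * star_pair a = a%:R * star_co a.
Proof.
have ak := ltn_ord a.
have e : ((2 * k - a) * 'C(2 * k, a) = 2 * k * 'C((2 * k).-1, a))%N.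
  by rewrite -mul_bin_down.
move/(congr1 (fun n => n%:R : R)): e; rewrite !natrM natrB ?natrM; last by lia.
by rewrite -/(star_tot a) -/(star_co a) /star_pair => e; rewrite mulrBr e; ring.
Qed.

Lemma star_pairE (a : 'I_k) : star_pair a = a%:R / (2 * k%:R - a%:R) * star_co a.
Proof.
have ak := ltn_ord a.
have n0 : 2 * k%:R - a%:R != 0 :> R.
  by rewrite -natrM -natrB ?pnatr_eq0; lia.
by apply: (mulfI n0); rewrite star_pair_co mulrA mulrCA divff // mulr1.
Qed.

Lemma star_pair_ge0 (a : 'I_k) : 0 <= star_pair a.
Proof.
have ak := ltn_ord a; rewrite star_pairE; apply: mulr_ge0; last exact: ltW (star_co_gt0 a).
by apply: divr_ge0 => //; rewrite -natrM subr_ge0 ler_nat; lia.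
Qed.

Lemma P_ge0 a : 0 <= P a. Proof. by apply: mulr_ge0 => //; exact: star_pair_ge0. Qed.

Lemma K_mean : \sum_a P a * a%:R = D * K.
Proof.
have [D0|Dn] := eqVneq D 0; last by rewrite /K mulrCA divff // mulr1.
have Pz a : P a = 0.
  apply/eqP; have /eqP := D0; rewrite psumr_eq0 // => [|c _]; last exact: P_ge0.
  by move=> /allP /(_ a (mem_index_enum a)).
by rewrite D0 mul0r big1 // => a _; rewrite Pz mul0r.
Qed.

Lemma D_ge0 : 0 <= D. Proof. by apply: sumr_ge0 => a _; exact: P_ge0. Qed.

Lemma K_ge0 : 0 <= K.
Proof.
apply: divr_ge0; last exact: D_ge0.
by apply: sumr_ge0 => a _; apply: mulr_ge0 => //; exact: P_ge0.
Qed.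

Lemma K_le : (0 < k)%N -> K <= k%:R - 1.
Proof.
move=> k0; have [D0|Dn] := eqVneq D 0.
  by rewrite /K D0 invr0 mulr0 subr_ge0 ler1n.
have Dp : 0 < D by rewrite lt_def Dn D_ge0.
rewrite /K ler_pdivrMr // mulrC /D mulr_suml; apply: ler_sum => a _.
by apply: ler_wpM2l; [exact: P_ge0 | rewrite lerBrDr natr1 ler_nat].
Qed.

(** [star_disj a c] counts the disjoint pairs on levels [a], [c] that contain
    two given distinct points respectively.  In [alpha], the choice of [theta]
    is what makes stars belong to the kernel of the quadratic form: the
    [P]-mean of [theta a c] over [c] is [2 * k - a].  It is also of the form
    required by [weighted_squares], both as it stands and after the
    subtraction from [2 * k]. *)
Let theta (a c : 'I_k) : R := 2 * k%:R - a%:R - c%:R + K.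
Let star_disj (a c : 'I_k) : R := 'C((2 * k).-1 - a, c)%:R * star_co a.
Let alpha (a c : 'I_k) : R :=
  ((star_pair a * star_co c + star_pair c * star_co a) / 2
     + star_pair a * star_pair c * theta a c) / star_disj a c.

Lemma star_disj_gt0 a c : 0 < star_disj a c.
Proof.
apply: mulr_gt0; last exact: star_co_gt0.
by rewrite ltr0n bin_gt0; have := ltn_ord a; have := ltn_ord c; lia.
Qed.

(** Both sides are multinomial coefficients. *)
Lemma star_disjC a c : star_disj a c = star_disj c a.
Proof.
rewrite /star_disj /star_co -!natrM; congr (_%:R).
have ak := ltn_ord a; have ck := ltn_ord c.
set M := (2 * k).-1.
have F (x y : nat) : (x + y <= M)%N ->
   ('C(M - x, y) * 'C(M, x) * (x`! * y`! * (M - x - y)`!) = M`!)%N.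
  move=> h; have h1 : (y <= M - x)%N by lia.
  have h2 : (x <= M)%N by lia.
  by rewrite -(bin_fact h2) -(bin_fact h1); ring.
have Fa := F a c; have Fc := F c a.
have e : (M - a - c = M - c - a)%N by lia.
have pos : (0 < a`! * c`! * (M - a - c)`!)%N by rewrite !muln_gt0 !fact_gt0.
apply/eqP; rewrite -(eqn_pmul2r pos); apply/eqP.
rewrite Fa; last by lia.
by rewrite e (mulnC a`!) Fc //; lia.
Qed.

Lemma theta_ge0 a c : 0 <= theta a c.
Proof.
have := K_ge0; have ak := ltn_ord a; have ck := ltn_ord c.
have : (a + c)%:R <= (2 * k)%:R :> R by rewrite ler_nat; lia.
by rewrite natrD natrM /theta; lra.
Qed.

Lemma alpha_ge0 a c : 0 <= alpha a c.
Proof.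
have := star_pair_ge0 a; have := star_pair_ge0 c; have := ltW (star_co_gt0 a); have := ltW (star_co_gt0 c).
move=> h1 h2 h3 h4; have h5 := theta_ge0 a c.
apply: divr_ge0; last exact: ltW (star_disj_gt0 a c).
by apply: addr_ge0; rewrite ?divr_ge0 ?addr_ge0 ?mulr_ge0.
Qed.

Lemma alphaC a c : alpha a c = alpha c a.
Proof.
rewrite /alpha (star_disjC a c); congr (_ / _).
by rewrite /theta; ring.
Qed.

Lemma alpha_disj_weight (a c : 'I_k) :
  (2 * k%:R - a%:R) * (2 * k%:R - 1 - a%:R) * (alpha a c * disj_weight R V a c)
  = star_pair c * ((a%:R * (2 * k%:R - c%:R) + c%:R * (2 * k%:R - a%:R)) / 2
       + a%:R * c%:R * theta a c).
Proof.
have ak := ltn_ord a; have ck := ltn_ord c.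
have r0 := lt0r_neq0 (star_co_gt0 a).
have C0 : 'C((2 * k).-1 - a, c)%:R != 0 :> R by rewrite pnatr_eq0 -lt0n bin_gt0; lia.
have n0 : 2 * k%:R - a%:R != 0 :> R by rewrite -natrM -natrB ?pnatr_eq0; lia.
have e1 : 2 * k%:R - 1 - a%:R = ((2 * k).-1 - a)%:R :> R.
  by rewrite natrB; [congr (_ - _); rewrite -subn1 natrB ?natrM //; lia | lia].
have n1 : ((2 * k).-1 - a)%:R != 0 :> R by rewrite pnatr_eq0; lia.
have e2 : (#|V| - 2 - a = (2 * k).-1 - a)%N by rewrite cV; lia.
rewrite e1 /alpha /disj_weight e2 /star_disj.
have -> : c%:R / ((2 * k).-1 - a)%:R * 'C((2 * k).-1 - a, c)%:R
  = c%:R * 'C((2 * k).-1 - a, c)%:R / ((2 * k).-1 - a)%:R :> R by rewrite mulrAC.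
set C := 'C(_, c)%:R in C0 *; set N := ((2 * k).-1 - a)%:R in n1 *.
have ec : c%:R * star_co c = (2 * k%:R - c%:R) * star_pair c by rewrite star_pair_co.
transitivity ((2 * k%:R - a%:R) *
  (((star_pair a * (c%:R * star_co c) + c%:R * star_pair c * star_co a) / 2
    + star_pair a * star_pair c * c%:R * theta a c) / star_co a)).
  field. by rewrite n1 r0 C0.
rewrite ec star_pairE.
set m : R := k%:R in n0 *.
field. by rewrite r0 n0.
Qed.

(** The factor [a / (2 * k - a)] spreads the weight [a = #|S| - 1] of a set [S]
    evenly over the [2 * k - a] points outside it. *)
Lemma coweight_average_le :
  \sum_(a < k) \sum_(c < k) w a * w c * (a%:R / (2 * k%:R - a%:R)) *
     \sum_y (total (f a) - wdegree (f a) y) * wdegree (f c) y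
  <= D * \sum_(a < k) a%:R * w a * total (f a).
Proof.
have exb (a : 'I_k) : exists b : (V -> R) * ({set V} -> R),
    [/\ forall S, f a S = lin a.+1 b.1 S + b.2 S, on_level a.+1 b.2, harmonic b.2 & total b.2 = 0].
  have [|b [h H]] := @lin_harmonic_decomp R V a (f a) _ (@lf a).
    by rewrite cV; have := ltn_ord a; lia.
  by exists (b, h).
have [bh Hbh] := fin_all_exists exb.
pose b a := (bh a).1; pose h a := (bh a).2.
have fE a S : f a S = lin a.+1 (b a) S + h a S by case: (Hbh a).
have lh (a : 'I_k) : on_level a.+1 (h a) by case: (Hbh a).
have hh a : harmonic (h a) by case: (Hbh a).
have th0 a : total (h a) = 0 by case: (Hbh a).
pose be a := \sum_y b a y.
pose B a c := \sum_y b a y * b c y.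
pose H a := dot (h a) (h a).
have totE (a : 'I_k) : total (f a) = star_tot a * be a.
  have -> : total (f a) = total (lin a.+1 (b a)) + total (h a).
    by rewrite /total -big_split; apply: eq_bigr => S _ /=; rewrite fE.
  rewrite th0 addr0 total_lin /star_tot cV; congr ('C(_, _)%:R * _); lia.
have codegE (a : 'I_k) y : total (f a) - wdegree (f a) y = star_co a * (be a - b a y).
  have -> : wdegree (f a) y = wdegree (lin a.+1 (b a)) y + wdegree (h a) y.
    by rewrite /wdegree -big_split; apply: eq_bigr => S _ /=; rewrite fE.
  rewrite hh addr0.
  have -> : total (f a) = total (lin a.+1 (b a)).
    by rewrite totE total_lin /star_tot cV; congr ('C(_, _)%:R * _); lia.
  rewrite cowdegree_lin /star_co cV; congr ('C(_, _)%:R * _); lia.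
have degE (a : 'I_k) y : wdegree (f a) y = star_co a * b a y + star_pair a * be a.
  have := codegE a y; rewrite totE /star_pair => e.
  have -> : wdegree (f a) y = star_tot a * be a - (star_tot a * be a - wdegree (f a) y) by ring.
  by rewrite e; ring.
have ipE (a : 'I_k) : dot (f a) (f a) = star_co a * B a a + star_pair a * be a ^+ 2 + H a.
  have e0 : dot (lin a.+1 (b a)) (h a) = 0.
    by rewrite dot_lin // big1 // => y _; rewrite hh mulr0.
  have -> : dot (f a) (f a) = dot (lin a.+1 (b a)) (f a) + (H a + dot (lin a.+1 (b a)) (h a)).
    by rewrite /H /dot -!big_split; apply: eq_bigr => S _ /=; rewrite !fE; ring.
  rewrite e0 addr0 dot_lin //; congr (_ + _).
  under eq_bigr do rewrite degE.
  transitivity (\sum_y (star_co a * (b a y * b a y) + star_pair a * be a * b a y)).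
    by apply: eq_bigr => y _; ring.
  by rewrite big_split /= -!mulr_sumr -/(be a) -/(B a a); ring.
have disE (a c : 'I_k) : disj (f a) (f c)
    = star_disj a c * (be a * be c - B a c) + disj (h a) (h c).
  have -> : disj (f a) (f c) = disj (f a) (lin c.+1 (b c)) + disj (f a) (h c).
    by rewrite -disjDr; apply: eq_bigr => S _; apply: eq_bigr => T _; rewrite (fE c).
  have -> : disj (f a) (h c) = disj (lin a.+1 (b a)) (h c) + disj (h a) (h c).
    by rewrite -disjDl; apply: eq_bigr => S _; apply: eq_bigr => T _; rewrite (fE a).
  have -> : disj (lin a.+1 (b a)) (h c) = 0.
    rewrite disjC (disj_lin _ _ (lh c)) big1 ?mulr0 // => y _.
    by rewrite th0 hh subrr mulr0.
  rewrite add0r (disj_lin _ _ (@lf a)); congr (_ + _).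
  have -> : (#|V| - a.+2 = (2 * k).-1 - a)%N by rewrite cV; lia.
  rewrite /star_disj -mulrA; congr (_ * _).
  transitivity (\sum_y (star_co a * be a * b c y - star_co a * (b a y * b c y))).
    by apply: eq_bigr => y _; rewrite codegE; ring.
  by rewrite sumrB -!mulr_sumr -/(be c) -/(B a c); ring.
pose X a c := be a * be c - B a c.
have Xsym a c : X a c = X c a.
  by rewrite /X mulrC /B; congr (_ - _); apply: eq_bigr => y _; rewrite mulrC.
pose S1 := \sum_a \sum_c P a * (w c * star_co c) * X a c.
pose S2 := \sum_a \sum_c P a * P c * theta a c * X a c.
pose EH := \sum_a \sum_c w a * w c * alpha a c * disj (h a) (h c).
(* alpha times the disjointness sums, all zero, split into a linear and a harmonic part *)
have Z0 : S1 + S2 + EH = 0.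
  have S1' : S1 = \sum_a \sum_c (P a * (w c * star_co c) + P c * (w a * star_co a)) / 2 * X a c.
    have e : S1 = \sum_a \sum_c P c * (w a * star_co a) * X a c.
      rewrite /S1 exchange_big /=; apply: eq_bigr => a _; apply: eq_bigr => c _.
      by rewrite Xsym.
    have -> : S1 = (S1 + S1) / 2 by field.
    rewrite {2}e /S1 -big_split mulr_suml; apply: eq_bigr => a _.
    rewrite -big_split mulr_suml; apply: eq_bigr => c _ /=; by field.
  rewrite S1' /S2 /EH -!big_split big1 // => a _; rewrite -!big_split big1 // => c _ /=.
  have n0 := lt0r_neq0 (star_disj_gt0 a c).
  have e : w a * w c * alpha a c * (star_disj a c * X a c + disj (h a) (h c)) = 0.
    by rewrite /X -disE dis0 mulr0.
  rewrite -[RHS]e /alpha /P; field. by rewrite n0.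
(* harmonic part: symmetric coefficients turn the pairwise bound into row sums *)
have EHb : - (D * \sum_(a < k) a%:R * w a * H a) <= EH.
  have s1 : - \sum_a \sum_c w a * w c * alpha a c *
        (disj_weight R V a c * H a + disj_weight R V c a * H c) <= 2 * EH.
    rewrite /EH mulr_sumr -sumrN; apply: ler_sum => a _; rewrite mulr_sumr -sumrN.
    apply: ler_sum => c _.
    have acV : (a + c + 2 <= #|V|)%N by rewrite cV; have := ltn_ord a; have := ltn_ord c; lia.
    have := disj_harmonic_bound acV (lh a) (hh a) (lh c) (hh c) => bd.
    have c0 : 0 <= w a * w c * alpha a c by apply: mulr_ge0; [exact: mulr_ge0 | exact: alpha_ge0].
    have := ler_wpM2l c0 bd; rewrite -/(H a) -/(H c); lra.
  have s2 : \sum_a \sum_c w a * w c * alpha a c *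
        (disj_weight R V a c * H a + disj_weight R V c a * H c)
     = 2 * \sum_a w a * H a * \sum_c w c * (alpha a c * disj_weight R V a c).
    have e : \sum_a \sum_c w a * w c * alpha a c * (disj_weight R V c a * H c)
        = \sum_a \sum_c w a * w c * alpha a c * (disj_weight R V a c * H a).
      rewrite exchange_big /=; apply: eq_bigr => a _; apply: eq_bigr => c _.
      by rewrite alphaC; ring.
    transitivity (\sum_a \sum_c w a * w c * alpha a c * (disj_weight R V a c * H a)
      + \sum_a \sum_c w a * w c * alpha a c * (disj_weight R V c a * H c)).
      by rewrite -big_split; apply: eq_bigr => a _; rewrite -big_split;
         apply: eq_bigr => c _ /=; ring.
    rewrite e; have dbl (t : R) : t + t = 2 * t by ring.
    rewrite dbl; congr (_ * _); apply: eq_bigr => a _.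
    by rewrite mulr_sumr; apply: eq_bigr => c _ /=; ring.
  have s3 : \sum_a w a * H a * \sum_c w c * (alpha a c * disj_weight R V a c)
      <= D * \sum_(a < k) a%:R * w a * H a.
    rewrite mulr_sumr; apply: ler_sum => a _.
    have H0 : 0 <= H a by apply: dot_ge0.
    have ak := ltn_ord a.
    case: (posnP a) => [a0|a0].
      have -> : H a = 0.
        apply: big1 => S _; rewrite (harmonic_level1_eq0 _ (hh a)) ?mul0r //.
        by have := lh a; rewrite a0.
      by rewrite !(mulr0, mul0r).
    have -> : D * (a%:R * w a * H a) = w a * H a * (a%:R * D) by ring.
    apply: ler_wpM2l; first exact: mulr_ge0.
    have rb := @row_bound R k P K a; rewrite a0 ak in rb.
    have {}rb := rb isT P_ge0 K_mean (K_le (leq_trans a0 (ltnW ak))).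
    have pos : 0 < (2 * k%:R - a%:R) * (2 * k%:R - 1 - a%:R) :> R.
      have h1 : a%:R + 1 <= k%:R :> R by rewrite natr1 ler_nat.
      have h2 : 0 <= a%:R :> R by [].
      by apply: mulr_gt0; lra.
    rewrite -(ler_pM2l pos); apply: le_trans (le_trans rb _).
      rewrite mulr_sumr le_eqVlt; apply/orP; left; apply/eqP; apply: eq_bigr => c _.
      by rewrite mulrCA alpha_disj_weight /P /theta; ring.
    by rewrite le_eqVlt; apply/orP; left; apply/eqP; rewrite -/D; ring.
  by lra.
(* the terms with star_co are the same as in Z0, and so cancel *)
have lhsE : \sum_(a < k) \sum_(c < k) w a * w c * (a%:R / (2 * k%:R - a%:R)) *
     (\sum_y (total (f a) - wdegree (f a) y) * wdegree (f c) y)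
   = S1 + 2 * k%:R * \sum_a \sum_c P a * P c * (be a * be c).
  rewrite /S1 mulr_sumr -big_split; apply: eq_bigr => a _.
  rewrite mulr_sumr -big_split; apply: eq_bigr => c _ /=.
  have -> : \sum_y (total (f a) - wdegree (f a) y) * wdegree (f c) y
    = star_co a * (star_co c * X a c + star_pair c * be c * (2 * k%:R * be a)).
    transitivity (\sum_y (star_co a * be a * star_co c * b c y
          - star_co a * star_co c * (b a y * b c y)
          + star_co a * be a * star_pair c * be c - star_co a * star_pair c * be c * b a y)).
      by apply: eq_bigr => y _; rewrite codegE degE; ring.
    rewrite sumrB big_split sumrB /= sumr_const -!mulr_sumr -/(be c) -/(B a c) -/(be a).
    by rewrite cV -[_ *+ (2 * k + 1)]mulr_natr natrD natrM /X; ring.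
  by rewrite /P (star_pairE a); ring.
rewrite lhsE.
have eqK := K_mean.
(* variances of the sums of coefficients, and of the coefficients at each point *)
have sqb := @weighted_squares R k P (fun a => a%:R) be K P_ge0 (fun a => ler0n _ _) eqK.
have sqy y : \sum_a \sum_c P a * P c * theta a c * (b a y * b c y)
    <= D * \sum_(a < k) P a * (2 * k%:R - a%:R) * b a y ^+ 2.
  have := @weighted_squares R k P (fun a => 2 * k%:R - a%:R) (b ^~ y) (2 * k%:R - K) P_ge0.
  move=> /(_ _ _) ws; have {}ws := ws _ _.
  apply: le_trans (ws _ _).
  - rewrite le_eqVlt; apply/orP; left; apply/eqP; apply: eq_bigr => a _; apply: eq_bigr => c _.
    by rewrite /theta; ring.
  - by move=> a; rewrite -natrM subr_ge0 ler_nat; have := ltn_ord a; lia.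
  - under eq_bigr do rewrite mulrBr.
    by rewrite sumrB -mulr_suml eqK -/D; ring.
have sqB : \sum_a \sum_c P a * P c * theta a c * B a c
    <= D * \sum_(a < k) P a * (2 * k%:R - a%:R) * B a a.
  have -> : \sum_a \sum_c P a * P c * theta a c * B a c
    = \sum_y \sum_a \sum_c P a * P c * theta a c * (b a y * b c y).
    rewrite [RHS]exchange_big; apply: eq_bigr => a _; rewrite exchange_big.
    by apply: eq_bigr => c _ /=; rewrite /B mulr_sumr.
  have -> : D * (\sum_(a < k) P a * (2 * k%:R - a%:R) * B a a)
    = \sum_y D * (\sum_(a < k) P a * (2 * k%:R - a%:R) * b a y ^+ 2).
    rewrite -mulr_sumr exchange_big; congr (_ * _); apply: eq_bigr => a _.
    by rewrite /B mulr_sumr; apply: eq_bigr => y _; rewrite expr2.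
  by apply: ler_sum.
have main : D * \sum_(a < k) a%:R * w a * dot (f a) (f a)
    <= D * \sum_(a < k) a%:R * w a * total (f a).
  apply: ler_wpM2l; first exact: D_ge0.
  by apply: ler_sum => a _; apply: ler_wpM2l => //; apply: mulr_ge0.
apply: le_trans main.
have -> : \sum_(a < k) a%:R * w a * dot (f a) (f a)
   = \sum_(a < k) P a * (2 * k%:R - a%:R) * B a a + \sum_(a < k) P a * a%:R * be a ^+ 2
     + \sum_(a < k) a%:R * w a * H a.
  rewrite -!big_split; apply: eq_bigr => a _ /=; rewrite ipE /P.
  have e := star_pair_co a.
  have -> : w a * star_pair a * (2 * k%:R - a%:R) * B a a
      = w a * ((2 * k%:R - a%:R) * star_pair a) * B a a by ring.
  by rewrite e; ring.
have S2E : 2 * k%:R * (\sum_a \sum_c P a * P c * (be a * be c)) - S2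
  = \sum_a \sum_c P a * P c * theta a c * B a c
   + \sum_(a < k) \sum_(c < k) P a * P c * (a%:R + c%:R - K) * (be a * be c).
  rewrite mulr_sumr /S2 -sumrB -big_split; apply: eq_bigr => a _.
  rewrite mulr_sumr -sumrB -big_split; apply: eq_bigr => c _ /=.
  by rewrite /X /theta; ring.
rewrite -/D in sqb.
move: sqb sqB EHb Z0 S2E; rewrite !mulrDr; lra.
Qed.

Hypothesis k0 : (0 < k)%N.
Hypothesis f0 : forall a S, 0 <= f a S.

(** If all degrees exceed [D], the averaging inequality forces all averaging
    weights [m y] to vanish.  So the family lives on singletons, and gives
    weight to all of them, although distinct singletons are disjoint. *)
Lemma exists_light_vertex : exists y, \sum_a w a * wdegree (f a) y <= D.
Proof.
have [/existsP //|] := boolP [exists y, \sum_a w a * wdegree (f a) y <= D].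
rewrite negb_exists => /forallP heavy.
have {}heavy y : D < \sum_a w a * wdegree (f a) y by rewrite ltNge.
exfalso.
have ak1 (a : 'I_k) : a%:R + 1 <= k%:R :> R by rewrite natr1 ler_nat.
have d0 (a : 'I_k) : 0 < 2 * k%:R - a%:R :> R.
  by have := ak1 a; have : 0 <= a%:R :> R by []; lra.
have dg0 a y : 0 <= wdegree (f a) y by apply: sumr_ge0.
have cd0 a y : 0 <= total (f a) - wdegree (f a) y by rewrite total_sub_wdegree sumr_ge0.
pose m y := \sum_(a < k) w a * (a%:R / (2 * k%:R - a%:R)) * (total (f a) - wdegree (f a) y).
have t0 (a : 'I_k) y : 0 <= w a * (a%:R / (2 * k%:R - a%:R)) * (total (f a) - wdegree (f a) y).
  by apply: mulr_ge0 => //; apply: mulr_ge0 => //; apply: divr_ge0 => //; exact: ltW.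
have m0 y : 0 <= m y by apply: sumr_ge0.
have sm : \sum_y m y = \sum_(a < k) a%:R * w a * total (f a).
  rewrite exchange_big; apply: eq_bigr => a _ /=.
  rewrite -mulr_sumr sumrB sumr_const (sum_wdegree (@lf a)) cV -[_ *+ (2 * k + 1)]mulr_natr.
  rewrite natrD natrM -natr1; field.
  by rewrite lt0r_neq0.
have le0 : \sum_y m y * (\sum_a w a * wdegree (f a) y - D) <= 0.
  under eq_bigr do rewrite mulrBr.
  rewrite sumrB -mulr_suml sm subr_le0 [leRHS]mulrC; apply: le_trans coweight_average_le.
  rewrite le_eqVlt; apply/orP; left; apply/eqP.
  transitivity (\sum_y \sum_(a < k) \sum_(c < k) w a * w c * (a%:R / (2 * k%:R - a%:R)) *
     ((total (f a) - wdegree (f a) y) * wdegree (f c) y)).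
    apply: eq_bigr => y _; rewrite mulr_suml; apply: eq_bigr => a _.
    by rewrite mulr_sumr; apply: eq_bigr => c _ /=; ring.
  rewrite exchange_big; apply: eq_bigr => a _; rewrite exchange_big; apply: eq_bigr => c _.
  by rewrite mulr_sumr.
have mz y : m y = 0.
  have tm z : 0 <= m z * (\sum_a w a * wdegree (f a) z - D).
    by apply: mulr_ge0 => //; rewrite subr_ge0 ltW.
  have : \sum_z m z * (\sum_a w a * wdegree (f a) z - D) == 0.
    by rewrite eq_le le0 sumr_ge0.
  rewrite psumr_eq0 // => /allP /(_ y (mem_index_enum y)) /=.
  by rewrite mulf_eq0 subr_eq0 (gt_eqF (heavy y)) orbF => /eqP.
have tz (a : 'I_k) : (0 < a)%N -> w a * total (f a) = 0.
  move=> a0; have : \sum_y m y = 0 by apply: big1.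
  rewrite sm => /eqP; rewrite psumr_eq0; last first.
    by move=> c _; apply: mulr_ge0; [apply: mulr_ge0|apply: sumr_ge0].
  move=> /allP /(_ a (mem_index_enum a)) /=.
  by rewrite -mulrA mulf_eq0 pnatr_eq0 eqn0Ngt a0 => /eqP.
pose o : 'I_k := Ordinal k0.
have degE y : \sum_a w a * wdegree (f a) y = w o * f o [set y].
  rewrite (bigD1 o) //= [X in _ + X]big1 ?addr0 => [|a ao].
    congr (_ * _); rewrite /wdegree (bigD1 [set y]) ?inE //= big1 ?addr0 // => T /andP[yT nT].
    apply: (@lf o); apply: contra nT => /cards1P[z eT].
    by move: yT; rewrite eT inE => /eqP ->.
  have a0 : (0 < a)%N by rewrite lt0n; apply: contra ao => /eqP e; apply/eqP/val_inj.
  apply/eqP; rewrite eq_le (mulr_ge0 (w0 a) (dg0 a y)) andbT -(tz a a0).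
  by apply: ler_wpM2l => //; rewrite -subr_ge0.
have fo y : f o [set y] != 0.
  apply/eqP => e; have := heavy y; rewrite degE e mulr0 => /(le_lt_trans D_ge0).
  by rewrite ltxx.
have /card_gt1P[y [z [_ _ yz]]] : (1 < #|[set: V]|)%N by rewrite cardsT cV; lia.
have /eqP := dis0 o o; rewrite /disj psumr_eq0; last first.
  by move=> S _; apply: sumr_ge0 => T _; apply: mulr_ge0.
move=> /allP /(_ [set y] (mem_index_enum _)) /=.
rewrite psumr_eq0; last by move=> T _; apply: mulr_ge0.
move=> /allP /(_ [set z] (mem_index_enum _)) /=.
by rewrite disjoints1 inE yz /= mulf_eq0 !(negbTE (fo _)).
Qed.
End Key.

(** * Shifting into a set *)

Section Shift.
Variables (n k : nat).
Implicit Types (A B Y : {set 'I_n}) (F G : {set {set 'I_n}}) (x y z : 'I_n).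

Definition moved y z G A :=
  [&& z \in A, y \notin A & (y |: A :\ z) \notin G].
Definition shift_set y z G A := if moved y z G A then y |: A :\ z else A.
Definition shift y z G := shift_set y z G @: G.

(** A set moves only if its image is not in [G] already, so a moved set cannot
    collide with a set that stays. *)
Lemma shift_set_inj y z G : {in G &, injective (shift_set y z G)}.
Proof.
move=> A B AG BG; rewrite /shift_set.
case: ifPn => [/and3P[zA yA nA]|_]; case: ifPn => [/and3P[zB yB nB]|_] //.
- move=> e; rewrite -(setD1K zA) -(setD1K zB); congr (_ |: _).
  by rewrite -(@setU1K _ y (A :\ z)) ?e ?setU1K //
       !inE (negbTE yA, negbTE yB) ?(negbTE yA) ?(negbTE yB) andbF.
- by move=> e; rewrite e BG in nA.
- by move=> e; rewrite -e AG in nB.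
Qed.

Lemma card_shift_set y z G A : #|shift_set y z G A| = #|A|.
Proof.
rewrite /shift_set; case: ifP => // /and3P[zA yA _].
by rewrite cardsU1 (cardsD1 z A) zA !inE (negbTE yA) andbF.
Qed.

Lemma shift_uniform y z G : G \subset k_subsets n k -> shift y z G \subset k_subsets n k.
Proof.
move=> /subsetP Gk; apply/subsetP => B /imsetP[A AG ->].
by have := Gk A AG; rewrite !inE card_shift_set.
Qed.

Lemma degree_shift x y z G : x != z -> degree G x <= degree (shift y z G) x.
Proof.
move=> xz; rewrite /degree.
rewrite -(card_in_imset (f := shift_set y z G) (D := [set A in G | x \in A])); last first.
  by move=> A B; rewrite !inE => /andP[AG _] /andP[BG _]; exact: shift_set_inj.
apply/subset_leq_card/subsetP => B /imsetP[A]; rewrite !inE => /andP[AG xA] ->.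
rewrite imset_f //= /shift_set; case: ifP => // _.
by rewrite !inE xz xA orbT.
Qed.

Lemma degree_shift_gt y z G A : y != z -> A \in G -> moved y z G A ->
  degree G y < degree (shift y z G) y.
Proof.
move=> yz AG mA; have /and3P[zA yA nA] := mA; rewrite /degree.
rewrite -(card_in_imset (f := shift_set y z G) (D := [set A in G | y \in A])); last first.
  by move=> B C; rewrite !inE => /andP[BG _] /andP[CG _]; exact: shift_set_inj.
apply/proper_card/properP; split.
  apply/subsetP => B /imsetP[C]; rewrite !inE => /andP[CG yC] ->.
  rewrite imset_f //= /shift_set; case: ifP => // _.
  by rewrite !inE eqxx.
exists (shift_set y z G A).
  by rewrite inE imset_f // /shift_set mA !inE eqxx.
apply/imsetP => -[C]; rewrite inE => /andP[CG yC] /(shift_set_inj AG CG) e.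
by rewrite e yC in yA.
Qed.

Lemma meetP A B : reflect (exists2 x, x \in A & x \in B) (0 < #|A :&: B|).
Proof.
apply: (iffP card_gt0P) => [[x]|[x xA xB]]; last by exists x; rewrite inE xA.
by rewrite inE => /andP[]; exists x.
Qed.

(** Two moved sets share [y].  If [A] moves and [B] does not, they could become
    disjoint only when [z] is their only common element and [y \notin B]; then
    [B] stays because [y |: B :\ z] is in [G], and this set misses [A]. *)
Lemma shift_intersecting y z G : intersecting G -> intersecting (shift y z G).
Proof.
move=> iG.
have half A B : A \in G -> B \in G -> moved y z G A -> ~~ moved y z G B ->
    exists2 x, x \in (y |: A :\ z) & x \in B.
  move=> AG BG /and3P[zA yA nA] nmB.
  have [yB|yB] := boolP (y \in B); first by exists y; rewrite ?setU11.
  have [zB|zB] := boolP (z \in B); last first.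
    have /meetP[x xA xB] := iG A B AG BG; exists x => //.
    by rewrite !inE xA andbT; apply/orP; right; apply: contra zB => /eqP <-.
  have B'G : y |: B :\ z \in G by move: nmB; rewrite /moved zB yB /= negbK.
  have /meetP[x xA] := iG A _ AG B'G; rewrite !inE => /orP[/eqP e|/andP[xz xB]].
    by rewrite -e xA in yA.
  by exists x => //; rewrite !inE xz xA orbT.
move=> _ _ /imsetP[A AG ->] /imsetP[B BG ->]; apply/meetP; rewrite /shift_set.
case: ifPn => mA; case: ifPn => mB.
- by exists y; rewrite setU11.
- exact: half.
- by have [x xB xA] := half B A BG AG mB mA; exists x.
- exact/meetP/iG.
Qed.

(** A family that maximises the sum of the degrees in [Y] cannot be changed by a
    shift from outside [Y] to [y \in Y], which would increase the degree of
    [y] and decrease no other one in [Y]. *)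
Lemma exists_shifted Y F : F \subset k_subsets n k -> intersecting F ->
  exists G, [/\ G \subset k_subsets n k, intersecting G,
    {in Y, forall y, degree F y <= degree G y}
  & {in G, forall A y z, y \in Y -> y \notin A -> z \notin Y -> z \in A ->
       y |: A :\ z \in G}].
Proof.
move=> Fk iF.
pose good G := [&& G \subset k_subsets n k,
  [forall A in G, forall B in G, 0 < #|A :&: B|]
  & [forall y in Y, degree F y <= degree G y]].
have goodP G : reflect [/\ G \subset k_subsets n k, intersecting G
    & {in Y, forall y, degree F y <= degree G y}] (good G).
  apply: (iffP and3P) => -[h1 h2 h3]; split => //.
  - by move=> A B AG BG; have /forall_inP/(_ A AG)/forall_inP/(_ B BG) := h2.
  - by move=> y yY; have /forall_inP/(_ y yY) := h3.
  - by apply/forall_inP => A AG; apply/forall_inP => B BG; exact: h2.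
  - by apply/forall_inP.
have gF : good F by apply/goodP; split.
case: (@arg_maxnP _ F good (fun G => \sum_(y in Y) degree G y) gF) => G /goodP[Gk iG dG] maxG.
exists G; split=> // A AG y z yY yA zY zA.
apply: contraT => nA.
have yz : y != z by apply: contra yA => /eqP ->.
have mA : moved y z G A by apply/and3P.
have le x : x \in Y -> degree G x <= degree (shift y z G) x.
  by move=> xY; apply: degree_shift; apply: contra zY => /eqP <-.
have gS : good (shift y z G).
  apply/goodP; split; [exact: shift_uniform | exact: shift_intersecting|].
  by move=> x xY; apply: leq_trans (dG x xY) (le x xY).
have := maxG _ gS; apply: contraLR => _; rewrite -ltnNge.
rewrite (bigD1 y) //= [X in _ < X](bigD1 y) //= -addSn leq_add //.
  exact: degree_shift_gt mA.
by apply: leq_sum => x /andP[xY _]; exact: le.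
Qed.

(** As long as [A] and [B] meet outside [Y] only, some [y \in Y] is in neither,
    and exchanging a common element of [A] for [y] leaves a member of [G] that
    meets [B] in fewer elements, none of them new. *)
Lemma shifted_traces_meet Y G : G \subset k_subsets n k -> intersecting G ->
  2 * k <= #|Y| ->
  {in G, forall A y z, y \in Y -> y \notin A -> z \notin Y -> z \in A ->
       y |: A :\ z \in G} ->
  {in G &, forall A B, exists2 y, y \in Y & y \in A :&: B}.
Proof.
move=> /subsetP Gk iG cY sG A B AG BG.
have [m] := ubnP #|A :&: B|; elim: m A AG => // m IH A AG cAB.
have /meetP[z zA zB] := iG A B AG BG.
have [zY|zY] := boolP (z \in Y); first by exists z; rewrite ?inE ?zA.
have [y yY yAB] : exists2 y, y \in Y & y \notin A :|: B.
  apply/subsetPn; apply/negP => YAB.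
  have YS : Y \subset (A :|: B) :\ z by rewrite subsetD1 YAB.
  have := subset_leq_card YS.
  have := cardsUI A B; have := iG A B AG BG.
  have := Gk A AG; have := Gk B BG; rewrite !inE => /eqP -> /eqP ->.
  by have := cardsD1 z (A :|: B); rewrite !inE zA /=; move: cY;
    move: #|Y| #|_ :\ z| #|A :|: B| #|A :&: B| => c1 c2 c3 c4; lia.
move: yAB; rewrite inE negb_or => /andP[yA yB].
have sub : (y |: A :\ z) :&: B = (A :&: B) :\ z.
  apply/setP => x; rewrite !inE; case: (eqVneq x y) => [->|_] /=; last by rewrite andbA.
  by rewrite (negbTE yB) !andbF.
have cAB' : #|(y |: A :\ z) :&: B| < m.
  by rewrite sub; move: cAB; rewrite (cardsD1 z) inE zA zB; lia.
have [x xY] := IH _ (sG A AG y z yY yA zY zA) cAB'.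
by rewrite sub inE => /andP[_ xAB]; exists x.
Qed.
End Shift.

(** * Traces and the ranked degree *)

Section Trace.
Variables (n k : nat) (G : {set {set 'I_n}}) (Y : {set 'I_n}).
Let V : finType := {x : 'I_n | x \in Y}.
Implicit Types (A B : {set 'I_n}) (S T : {set V}).

Definition trace A : {set V} := [set v : V | val v \in A].

Lemma card_trace A : #|trace A| = #|A :&: Y|.
Proof.
rewrite -(card_imset _ val_inj); apply: eq_card => x; rewrite inE.
apply/imsetP/andP => [[v]|[xA xY]]; first by rewrite inE => vA ->; split=> //; exact: valP.
by exists (Sub x xY); rewrite ?inE SubK.
Qed.

Definition trace_mult S := #|[set A in G | trace A == S]|.

Hypothesis Gk : G \subset k_subsets n k.

(** A member with trace [S] is determined by its part outside [Y]. *)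
Lemma trace_mult_le S : trace_mult S <= 'C(n - #|Y|, k - #|S|).
Proof.
rewrite /trace_mult; have -> : n - #|Y| = #|~: Y| by rewrite -[n in n - _]card_ord -(cardsC Y) addKn.
rewrite -cards_draws -(card_in_imset (f := fun A => A :\: Y) (D := [set A in G | trace A == S])).
  apply/subset_leq_card/subsetP => B /imsetP[A /setIdP[AG /eqP tA] ->]; rewrite inE.
  have := subsetP Gk _ AG; rewrite !inE => /eqP cA.
  by rewrite setDE subsetIr -setDE cardsD cA -card_trace tA eqxx.
move=> A B /setIdP[_ /eqP tA] /setIdP[_ /eqP tB] e.
apply/setP => x; have [xY|xY] := boolP (x \in Y).
  have := congr1 (fun S : {set V} => (Sub x xY : V) \in S) (etrans tA (esym tB)).
  by rewrite !inE SubK.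
by have := congr1 (fun C : {set 'I_n} => x \in C) e; rewrite !inE xY.
Qed.

Lemma trace_mult_gt S : k < #|S| -> trace_mult S = 0.
Proof.
move=> kS; apply: eq_card0 => A; rewrite !inE; apply/negP => /andP[AG /eqP tA].
have := subsetP Gk _ AG; rewrite !inE => /eqP cA.
have := subset_leq_card (subsetIl A Y); rewrite -card_trace tA cA.
by rewrite leqNgt kS.
Qed.

Lemma degree_trace (y : V) : degree G (val y) = \sum_(S : {set V} | y \in S) trace_mult S.
Proof.
rewrite /degree -sum1_card (partition_big trace (fun S => y \in S)) /=; last first.
  by move=> A; rewrite !inE => /andP[].
apply: eq_bigr => S yS; rewrite /trace_mult -sum1_card; apply: eq_bigl => A.
rewrite !inE; case: eqP => [tA|]; rewrite ?andbF // !andbT.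
have : y \in trace A by rewrite tA.
by rewrite inE => ->; rewrite andbT.
Qed.

End Trace.

Section Main.
Local Open Scope ring_scope.

(** The weighted star degree is evaluated by Vandermonde's identity for each of
    the two binomial coefficients in the difference, followed by Pascal's
    rule. *)
Lemma weighted_vandermonde (k m : nat) : (0 < k)%N ->
  \sum_(a < k) 'C(m, k - a.+1)%:R * ('C(2 * k, a)%:R - 'C((2 * k).-1, a)%:R)
   = (binomz (2 * k + 1 + m - 2) (k%:Z - 2%:Z))%:R :> rat.
Proof.
case: k => // k _.
have F (N : nat) : \sum_(a < k.+1) 'C(m, k.+1 - a.+1)%:R * 'C(N, a)%:R = 'C(N + m, k)%:R :> rat.
  rewrite -binomial.Vandermonde natr_sum; apply: eq_bigr => a _.
  by rewrite natrM mulrC subSS.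
under eq_bigr do rewrite mulrBr.
rewrite sumrB !F.
have e1 : (2 * k.+1 + m = ((2 * k.+1).-1 + m).+1)%N by lia.
have e2 : (2 * k.+1 + 1 + m - 2 = (2 * k.+1).-1 + m)%N by lia.
rewrite e1 e2; case: k F e1 e2 => [|k] _ _ _.
  by rewrite !bin0 subrr.
have -> : (k.+2%:Z - 2%:Z)%R = k%:Z :> int by lia.
by rewrite binS natrD addrAC subrr add0r.
Qed.

(** The functions to which [exists_light_vertex] applies are the trace
    multiplicities divided by their upper bounds, which serve as weights.  A
    vanishing bound is harmless, as the multiplicity then vanishes too. *)
Lemma exists_light_in (n k : nat) (F : {set {set 'I_n}}) (Y : {set 'I_n}) :
  (0 < k)%N -> F \subset k_subsets n k -> intersecting F ->
  #|Y| = (2 * k + 1)%N ->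
  exists2 y, y \in Y & (degree F y <= binomz (n - 2) (k%:Z - 2%:Z)%R)%N.
Proof.
move=> k0 Fk iF cY.
have [G [Gk iG dG sG]] := exists_shifted Y Fk iF.
have cY' : (2 * k <= #|Y|)%N by rewrite cY leq_addr.
have mG := shifted_traces_meet Gk iG cY' sG.
pose V : finType := {x : 'I_n | x \in Y}.
have cV : #|V| = (2 * k + 1)%N by rewrite card_sig -cY.
pose w (a : 'I_k) : rat := 'C(n - #|Y|, k - a.+1)%:R.
pose f (a : 'I_k) (S : {set V}) : rat :=
  if #|S| == a.+1 then (trace_mult G S)%:R / w a else 0.
have w0 a : 0 <= w a by [].
have wf (a : 'I_k) (S : {set V}) : #|S| = a.+1 -> w a * f a S = (trace_mult G S)%:R.
  move=> cS; rewrite /f cS eqxx mulrC.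
  have [wz|wn] := eqVneq (w a) 0; last by rewrite divfK.
  rewrite wz mulr0; have := trace_mult_le Gk S; rewrite cS.
  by move/eqP: wz; rewrite pnatr_eq0 => /eqP -> ; rewrite leqn0 => /eqP ->.
have f01 a S : 0 <= f a S <= 1.
  rewrite /f; case: eqP => [cS|_]; last by rewrite lexx ler01.
  rewrite divr_ge0 //=; have := trace_mult_le Gk S; rewrite cS -(ler_nat rat) -/(w a).
  have [->|wn] := eqVneq (w a) 0; first by rewrite invr0 mulr0.
  by move=> le; rewrite ler_pdivrMr ?mul1r // lt_def wn w0.
have lf (a : 'I_k) : on_level a.+1 (f a) by move=> S /negbTE nS; rewrite /f nS.
have nf a : dot (f a) (f a) <= total (f a).
  apply: ler_sum => S _; have /andP[h0 h1] := f01 a S.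
  by rewrite -[leRHS]mulr1 ler_wpM2l.
have df a c : disj (f a) (f c) = 0.
  apply: big1 => S _; apply: big1 => T ST.
  have pos b (S' : {set V}) : f b S' != 0 -> exists2 A, A \in G & trace Y A = S'.
    rewrite /f; case: ifP => [_|_]; last by rewrite eqxx.
    rewrite mulf_eq0 negb_or pnatr_eq0 -lt0n => /andP[/card_gt0P[A]].
    by rewrite inE => /andP[AG /eqP tA] _; exists A.
  apply/eqP; rewrite mulf_eq0; apply: contraT; rewrite negb_or
    => /andP[/pos[A AG tA] /pos[B BG tB]].
  have [y yY] := mG A B AG BG; rewrite inE => /andP[yA yB].
  have := disjoint_setI0 ST; move/setP/(_ (Sub y yY)).
  by rewrite !inE -tA -tB !inE SubK yA yB.
have [y] := exists_light_vertex cV w0 lf nf df k0 (fun a S => proj1 (andP (f01 a S))).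
rewrite weighted_vandermonde //.
have -> : (2 * k + 1 + (n - #|Y|) - 2 = n - 2)%N.
  have : (#|Y| <= n)%N by rewrite -[n in (_ <= n)%N]card_ord max_card.
  by rewrite cY; lia.
move=> dy; exists (val y); first exact: valP.
apply: leq_trans (dG _ (valP y)) _; rewrite -(ler_nat rat); apply: le_trans dy.
rewrite degree_trace natr_sum.
have -> : \sum_a w a * wdegree (f a) y
    = \sum_(S : {set V} | y \in S) \sum_a w a * f a S.
  by rewrite exchange_big; apply: eq_bigr => a _; rewrite mulr_sumr.
apply: ler_sum => S yS.
have S0 : (0 < #|S|)%N by apply/card_gt0P; exists y.
have [Sk|kS] := leqP #|S| k; last first.
  by rewrite (trace_mult_gt Gk kS) sumr_ge0 // => a _; rewrite mulr_ge0 //; case/andP: (f01 a S).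
have aS : (#|S|.-1 < k)%N by rewrite prednK.
rewrite (bigD1 (Ordinal aS)) //= wf /= ?prednK // lerDl sumr_ge0 // => a _.
by rewrite mulr_ge0 //; case/andP: (f01 a S).
Qed.
End Main.

Lemma card_ranked_degree n (F : {set {set 'I_n}}) r d : 0 < r <= n ->
  d < ranked_degree F r -> r <= #|[set i | d < degree F i]|.
Proof.
move=> /andP[r0 rn]; rewrite /ranked_degree; set t := degree_seq F => dr.
have st : size t = n by rewrite size_sort size_map size_enum_ord.
have sorted_t : sorted geq t by apply: sort_sorted => x y; exact: leq_total.
have -> : #|[set i | d < degree F i]| = count (fun x => d < x) t.
  rewrite /t /degree_seq count_sort count_map -sum1_count big_enum_cond -sum1_card.
  by apply: eq_bigl => i; rewrite inE.
rewrite -(cat_take_drop r t) count_cat; apply: leq_trans (leq_addr _ _).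
have srt : size (take r t) = r by rewrite size_takel ?st.
suff : all (fun x => d < x) (take r t) by rewrite all_count srt => /eqP ->.
apply/(all_nthP 0) => i; rewrite srt => ir.
rewrite nth_take //; apply: leq_trans dr _.
have gt : transitive geq by move=> x y z /= h1 h2; exact: leq_trans h2 h1.
have := sorted_leq_nth gt leqnn 0 sorted_t; apply.
- by rewrite inE st; lia.
- by rewrite inE st; lia.
- by lia.
Qed.

Theorem theorem1p2 (n k : nat) (F : {set {set 'I_n}})
    (hk : 1 <= k) (hn : 2 * k + 1 <= n)
    (hF : F \subset k_subsets n k) (hint : intersecting F) :
  ranked_degree F (2 * k + 1) <= binomz (n - 2) (k%:Z - 2%:Z)%R.
Proof.
rewrite leqNgt; apply/negP => /card_ranked_degree.
rewrite addn1 ltnS leq0n -addn1 hn => /(_ isT).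
set heavy := [set i | _]; rewrite -bin_gt0 -cards_draws => /card_gt0P[Y].
rewrite inE => /andP[/subsetP Yh /eqP cY].
have [y yY] := exists_light_in hk hF hint cY.
by rewrite leqNgt; have := Yh y yY; rewrite inE => ->.
Qed.
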